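(* Let $\mathcal{F}$ be a finite family of polytopes in $\mathbb{R}^3$ such that $\chi(\mathrm{KG}^8(\mathcal{F}))=1$ (i.e., no eight polytopes of $\mathcal{F}$ are pairwise disjoint). Then $\mathcal{F}$ can be pierced by three affine hyperplanes in $\mathbb{R}^3$.
   Context: A polytope in $\mathbb{R}^3$ is the convex hull of a finite non-empty set of points of $\mathbb{R}^3$. For a finite family $\mathcal{F}$ of non-empty sets and an integer $r\ge 2$, the $r$-uniform Kneser hypergraph $\mathrm{KG}^r(\mathcal{F})$ has vertex set $\mathcal{F}$ and a hyperedge $\{A_1,\dots,A_r\}$ for every collection of pairwise disjoint $A_1,\dots,A_r\in\mathcal{F}$; $\chi(\mathrm{KG}^r(\mathcal{F}))$ is the smallest number of colors needed to color the vertices so that no hyperedge is monochromatic. A collection of (not necessarily distinct) hyperplanes pierces a family $\mathcal{F}$ of non-empty sets if the union of these hyperplanes intersects each set from $\mathcal{F}$. *)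

(* Defs.v *)
From HB Require Import structures.
From mathcomp Require Import all_boot all_order all_algebra.
From mathcomp Require Import all_classical all_reals all_analysis.

Set Implicit Arguments.
Unset Strict Implicit.
Unset Printing Implicit Defensive.

Import Order.TTheory GRing.Theory Num.Theory.

Local Open Scope classical_set_scope.
Local Open Scope card_scope.
Local Open Scope ring_scope.

Record hypergraph (V : Type) := Hypergraph {
  vertices : set V ;
  hyperedges : set (set V) }.

(* Colors are natural numbers < k rather than elements of 'I_k, so that a
   hypergraph without vertices is 0-colorable even when V is inhabited. *)
Definition colorable (V : Type) (H : hypergraph V) (k : nat) : Prop :=
  exists c : V -> nat,
    (forall v, vertices H v -> (c v < k)%N) /\
    (forall e, hyperedges H e -> ~ exists i, forall v, e v -> c v = i).

(* If no finite number of colors suffices, xget returns the default value 0. *)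
Definition chromatic_number (V : Type) (H : hypergraph V) : nat :=
  xget 0%N [set k | colorable H k /\ forall m, colorable H m -> (k <= m)%N].

Definition kneser (T : Type) (r : nat) (F : set (set T)) : hypergraph (set T) :=
  Hypergraph F [set e | [/\ e `<=` F, e #= `I_r & trivIset e id]].

Definition convex_hull (R : numDomainType) (E : lmodType R) (A : set E) :
  set E := smallest (@convex_set R E) A.

Definition polytope (R : realType) (n : nat) (P : set 'rV[R]_n) : Prop :=
  exists S : set 'rV[R]_n, [/\ finite_set S, S !=set0 & P = convex_hull S].

Definition affine_hyperplane (R : realType) (n : nat) (H : set 'rV[R]_n) :
  Prop :=
  exists (a : 'rV[R]_n) (b : R),
    a != 0 /\ H = [set x | \sum_(i < n) a ord0 i * x ord0 i = b].

(* The hyperplanes H i need not be distinct. *)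
Definition pierced_by (R : realType) (n k : nat) (F : set (set 'rV[R]_n)) :
  Prop :=
  exists H : 'I_k -> set 'rV[R]_n,
    (forall i, affine_hyperplane (H i)) /\
    (forall A, F A -> (\bigcup_i H i) `&` A !=set0).

(* Main.v *)
Require Import Defs.
From mathcomp Require Import all_boot all_order all_algebra.
From mathcomp Require Import all_classical all_reals all_analysis.
From mathcomp Require Import zify ring lra.

(** Call two finite point sets apart when some plane strictly separates them;
    hulls of apart sets are disjoint, so the polytopes, given by their vertices,
    contain no eight pairwise apart members.  The three planes are found along
    the lines of Hadwiger's proof that a mass in space can be cut by three
    planes into eight equal parts.

    A horizontal plane is used first.  Sweeping it upwards, there is a height
    at which neither the polytopes strictly below (the family A) nor those
    strictly above (the family B) contain four pairwise apart members, since
    four below and four above would make eight (balanced_cut).  It remains to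
    meet all of A and B with two planes (two_planes).

    Turn a direction r through half a turn, r in [0, 1].  For each r there is a
    distinguished plane h r whose horizontal traces have the direction given by r
    and which halves both families: neither of its open sides contains two apart
    members of A, nor two apart members of B.  For one family and a fixed tilt the
    halving heights form an interval, because A has no four pairwise apart
    members; the midpoint of this interval strictly increases with the tilt for
    A and strictly decreases for B, as they lie on opposite sides of the cutting
    plane.  So exactly one tilt serves both, it depends on r in a Lipschitz way,
    and h 1 is h 0 with the opposite orientation (bisecting_pencil).

    Two halving planes h r and h r' cut space into four quadrants.  Members of A
    in two adjacent quadrants would be separated by one of the planes and lie on
    the same side of the other, against halving; so the members of A missed by
    both planes lie in one pair of opposite quadrants only.  The signed depth
    skew, positive for one pair of quadrants and negative for the other, thus
    vanishes only if every member of A is met (hit_of_skew0).  The skews a of A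
    and b of B are continuous and symmetric in (r, r'), nonnegative for r = r',
    and change sign when r = 0 is replaced by r = 1.

    Such a and b have a common zero (common_zero).  Otherwise (a, b) maps the
    triangle 0 <= r <= r' <= 1 to the punctured plane.  Along the side r = 0 the
    image goes from a point to its opposite, turning by an odd multiple of pi;
    by symmetry and the change of sign it turns by the same amount along
    r' = 1.  The third side is mapped into a quadrant, so it cannot turn by the
    total, twice an odd multiple of pi, although the triangle is simply
    connected.  This winding argument is carried out with labels in Z/4 on a
    fine grid (no_antisymmetric_labelling). *)

Set Implicit Arguments.
Unset Strict Implicit.
Unset Printing Implicit Defensive.
Import Order.TTheory GRing.Theory Num.Theory.
Import numFieldNormedType.Exports.
Local Open Scope classical_set_scope.
Local Open Scope ring_scope.

(** * Winding of labels around a triangle *)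

(** The labels are the four half-axes of the plane in cyclic order, and turn is
    the signed number of quarter turns from one to the next.  Its value 2 for
    opposite labels has no meaning as a rotation; opposite excludes it. *)
Definition turn (a b : 'Z_4) : int := (val (b - a + 1))%:Z - 1.

Definition opposite (a b : 'Z_4) : bool := b == a + 2.

(** Three labels without opposite pair lie on two neighbouring half-axes, so no
    winding happens around a small triangle of the grid. *)
Lemma turnD (a b c : 'Z_4) :
  ~~ opposite a b -> ~~ opposite b c -> ~~ opposite a c ->
  turn a b + turn b c = turn a c.
Proof.
by move: a b c; do 3! case=> [[|[|[|[|?]]]] ?] //=.
Qed.

Lemma turn_shift (a b : 'Z_4) : turn (a + 2) (b + 2) = turn a b.
Proof. by rewrite /turn opprD addrACA subrr addr0. Qed.

Lemma turn_mod4 (a b : 'Z_4) : (turn a b)%:~R = b - a :> 'Z_4.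
Proof. by apply/eqP; move: a b; do 2! case=> [[|[|[|[|?]]]] ?] //=. Qed.

Lemma turn_diag (a b : 'Z_4) : (a < 2)%N -> (b < 2)%N ->
  turn a b = (b : nat)%:Z - (a : nat)%:Z.
Proof.
by move: a b; do 2! case=> [[|[|[|[|?]]]] ?] //=.
Qed.

(** The sides i = 0 and j = N of the triangle 0 <= i <= j <= N turn by the same
    amount V because of the last hypothesis, and the two together turn like the
    diagonal, which moves between labels 0 and 1 only.  So V = 0; but V is 2
    modulo 4, being the rotation from l 0 0 to l 0 N = l 0 0 + 2. *)
Lemma no_antisymmetric_labelling (N : nat) (l : nat -> nat -> 'Z_4) :
  (forall i j, (i <= j < N)%N -> ~~ opposite (l i j) (l i j.+1)) ->
  (forall i j, (i < j <= N)%N -> ~~ opposite (l i j) (l i.+1 j)) ->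
  (forall i j, (i <= j < N)%N -> ~~ opposite (l i j) (l i.+1 j.+1)) ->
  (forall i, (i <= N)%N -> (l i i < 2)%N) ->
  (forall j, (j <= N)%N -> l j N = l 0%N j + 2) ->
  False.
Proof.
move=> lV lH lD ldiag lanti.
pose V n : int := \sum_(j < n) turn (l 0%N j) (l 0%N j.+1).
pose H n : int := \sum_(i < n) turn (l i n) (l i.+1 n).
pose D n : int := \sum_(i < n) turn (l i i) (l i.+1 i.+1).
(* Push the horizontal path at height n up to height n + 1, one square at a
   time; each square splits into two triangles along its diagonal. *)
have rows n k : (k <= n < N)%N ->
    turn (l 0%N n) (l 0%N n.+1) + \sum_(i < k) turn (l i n.+1) (l i.+1 n.+1)
    = \sum_(i < k) turn (l i n) (l i.+1 n) + turn (l k n) (l k n.+1).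
  elim: k => [|k IH] kn; first by rewrite !big_ord0 addr0 add0r.
  rewrite !big_ord_recr /= addrA IH; last by lia.
  rewrite -[LHS]addrA -[RHS]addrA; congr (_ + _).
  by rewrite !turnD ?lV ?lH ?lD //; lia.
(* Filling the triangle row by row. *)
have VHD n : (n <= N)%N -> V n + H n = D n.
  elim: n => [|n IH] nN; first by rewrite /V /H /D !big_ord0.
  have := rows n n; rewrite leqnn nN => /(_ isT).
  have := @turnD (l n n) (l n n.+1) (l n.+1 n.+1).
  rewrite lV ?lH ?lD ?leqnn ?ltnSn //= => /(_ isT isT isT).
  by move: (IH (ltnW nN)); rewrite /V /H /D !big_ord_recr /=; lra.
have HV : H N = V N.
  apply: eq_bigr => i _; have iN := ltn_ord i.
  by rewrite !lanti ?turn_shift //; lia.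
have Dtel n : (n <= N)%N -> D n = (l n n : nat)%:Z - (l 0%N 0%N : nat)%:Z.
  elim: n => [|n IH] nN; first by rewrite /D big_ord0 subrr.
  rewrite /D big_ord_recr /= -/(D n) IH; last by lia.
  by rewrite turn_diag ?ldiag //; lia.
have Vtel n : (V n)%:~R = l 0%N n - l 0%N 0%N.
  elim: n => [|n IH]; first by rewrite /V big_ord0 subrr.
  by rewrite /V big_ord_recr /= -/(V n) rmorphD /= IH turn_mod4 addrC addrA subrK.
have V0 : V N = 0.
  have := VHD N (leqnn N); rewrite HV Dtel //.
  by have := ldiag N (leqnn N); have := ldiag 0%N isT; lia.
have := Vtel N; rewrite V0 lanti // addrC addKr.
by move/eqP.
Qed.

(** * A common zero of two antisymmetric functions *)

Section CommonZero.
Variable R : realType.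
Implicit Types a b : R -> R -> R.

(** The half-axis closest to the point (u, v). *)
Definition quadrant_label (u v : R) : 'Z_4 :=
  if `|v| <= `|u| then if 0 <= u then 0 else 2
  else if 0 <= v then 1 else 3.

Lemma quadrant_labelN (u v : R) : 0 < Num.max `|u| `|v| ->
  quadrant_label (- u) (- v) = quadrant_label u v + 2.
Proof.
rewrite /quadrant_label !normrN !oppr_ge0.
have [vu|uv] := lerP `|v| `|u|; rewrite normr_gt0 => n0.
  by case: ltgtP n0 => // _ _; apply/val_inj.
by case: ltgtP n0 => // _ _; apply/val_inj.
Qed.

Lemma quadrant_label_ge0 (u v : R) : 0 <= u -> 0 <= v ->
  (quadrant_label u v < 2)%N.
Proof. by rewrite /quadrant_label => -> ->; case: ifP. Qed.

(** Opposite labels come from the same dominating coordinate with opposite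
    signs, and this coordinate has absolute value at least e at both points. *)
Lemma opposite_label_far (e u v u' v' : R) :
  e <= Num.max `|u| `|v| -> e <= Num.max `|u'| `|v'| ->
  opposite (quadrant_label u v) (quadrant_label u' v') ->
  2 * e <= `|u - u'| \/ 2 * e <= `|v - v'|.
Proof.
rewrite /quadrant_label.
have [vu|uv] := lerP `|v| `|u|; have [vu'|uv'] := lerP `|v'| `|u'|.
- case: (lerP 0 u) => u0; case: (lerP 0 u') => u0' // e1 e2 _; left; move: e1 e2.
    by rewrite (ger0_norm u0) (ltr0_norm u0') ger0_norm; lra.
  by rewrite (ltr0_norm u0) (ger0_norm u0') ler0_norm; lra.
- by case: (lerP 0 u) => u0; case: (lerP 0 v') => u0'.
- by case: (lerP 0 v) => u0; case: (lerP 0 u') => u0'.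
- case: (lerP 0 v) => u0; case: (lerP 0 v') => u0' // e1 e2 _; right; move: e1 e2.
    by rewrite (ger0_norm u0) (ltr0_norm u0') ger0_norm; lra.
  by rewrite (ltr0_norm u0) (ger0_norm u0') ler0_norm; lra.
Qed.

Definition lipschitz_on_square (L : R) a :=
  forall x x' y y', 0 <= x <= 1 -> 0 <= x' <= 1 -> 0 <= y <= 1 -> 0 <= y' <= 1 ->
    `|a x y - a x' y'| <= L * (`|x - x'| + `|y - y'|).

Lemma lipschitz_on_square_ge0 L a : lipschitz_on_square L a -> 0 <= L.
Proof.
move=> /(_ 0 1 0 0); rewrite !lexx ler01 => /(_ isT isT isT isT).
by rewrite subrr normr0 addr0 sub0r normrN1 mulr1; exact: le_trans.
Qed.

Lemma continuous_on_square L a : lipschitz_on_square L a ->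
  {within (`[0, 1] `*` `[0, 1] : set (R * R)),
    continuous (fun p : R * R => a p.1 p.2)}.
Proof.
move=> La; have L0 := lipschitz_on_square_ge0 La.
apply/subspace_continuousP => -[x y] [/= xI yI]; apply/cvgrPdist_lt => e e0.
have d0 : 0 < e / (2 * L + 1) by rewrite divr_gt0 //; lra.
near=> q.
have [q1 q2] : ball (x, y) (e / (2 * L + 1)) q.
  by near: q; apply: cvg_within; exact: nbhsx_ballx.
have [qI1 qI2] : (`[0, 1] `*` `[0, 1] : set (R * R)) q.
  by near: q; exact: withinT.
move: xI yI qI1 qI2; rewrite /= !in_itv /= => xI yI qI1 qI2.
apply: le_lt_trans (La _ _ _ _ xI qI1 yI qI2) _.
move: q1 q2; rewrite /ball /= => q1 q2.
have : `|x - q.1| + `|y - q.2| <= 2 * (e / (2 * L + 1)) by lra.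
move=> /(ler_wpM2l L0)/le_lt_trans; apply.
rewrite !mulrA ltr_pdivrMr; nra.
Unshelve. all: by end_near. Qed.

(** The image of the compact square under the maximum is compact, hence closed,
    and it avoids 0. *)
Lemma positive_lower_bound a b L :
  lipschitz_on_square L a -> lipschitz_on_square L b ->
  (forall x y, 0 < Num.max `|a x y| `|b x y|) ->
  exists2 e, 0 < e & forall x y, 0 <= x <= 1 -> 0 <= y <= 1 ->
    e <= Num.max `|a x y| `|b x y|.
Proof.
move=> La Lb pos; pose f (p : R * R) : R := Num.max `|a p.1 p.2| `|b p.1 p.2|.
pose Q : set (R * R) := `[0, 1] `*` `[0, 1].
have fc : {within Q, continuous f}.
  apply: (@continuous_on_square L (fun x y => f (x, y))) => x x' y y' xI xI' yI yI'.
  have := le_trans (ler_dist_dist _ _) (La _ _ _ _ xI xI' yI yI').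
  have := le_trans (ler_dist_dist _ _) (Lb _ _ _ _ xI xI' yI yI').
  rewrite /f /= !ler_norml => /andP[b1 b2] /andP[a1 a2].
  have [?|?] := lerP `|a x y| `|b x y|; have [?|?] := lerP `|a x' y'| `|b x' y'|;
    apply/andP; split; lra.
have Qc : compact Q by apply: compact_setX; exact: segment_compact.
have /compact_closed := continuous_compact fc Qc.
move=> /(_ (@Rhausdorff R)) fQ; apply: contrapT => noe.
have : closure (f @` Q) 0.
  move=> B /nbhs_ballP[e /= e0 eB]; apply: contrapT => Bf; apply: noe; exists e => //.
  move=> x y xI yI; rewrite leNgt; apply/negP => lte; apply: Bf.
  exists (f (x, y)); split; first by exists (x, y) => //; split; rewrite /= in_itv.
  apply: eB; rewrite /ball /= sub0r normrN ger0_norm //.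
  exact: ltW (pos x y).
by move=> /fQ[p _ fp]; have := pos p.1 p.2; rewrite -/(f p) fp ltxx.
Qed.

(** If there were no common zero, the labels of the values of (a, b) on a grid
    too fine for neighbours to be opposite would contradict
    no_antisymmetric_labelling. *)
Lemma common_zero a b L :
  lipschitz_on_square L a -> lipschitz_on_square L b ->
  (forall x y, a x y = a y x) -> (forall x y, b x y = b y x) ->
  (forall y, a 1 y = - a 0 y) -> (forall y, b 1 y = - b 0 y) ->
  (forall x, 0 <= a x x) -> (forall x, 0 <= b x x) ->
  exists x y, a x y = 0 /\ b x y = 0.
Proof.
move=> La Lb aC bC aN bN a0 b0; apply: contrapT => noz.
have pos x y : 0 < Num.max `|a x y| `|b x y|.
  rewrite lt_max !normr_gt0; apply/negPn/negP.
  by rewrite negb_or !negbK => /andP[/eqP az /eqP bz]; apply: noz; exists x, y.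
have [e e0 emin] := positive_lower_bound La Lb pos.
(* The values at neighbours in a grid of this size differ by less than e. *)
have [N Nbig] : exists N, L * 2 < e * N.+1%:R.
  exists (Num.truncn (L * 2 / e)).
  by rewrite -ltr_pdivrMl // (mulrC e^-1); exact: truncnS_gt.
pose t i : R := i%:R / N.+1%:R.
have N0 : 0 < N.+1%:R :> R by rewrite ltr0n.
have t01 i : (i <= N.+1)%N -> 0 <= t i <= 1.
  move=> iN; rewrite /t divr_ge0 ?ler0n //= ler_pdivrMr // mul1r ler_nat //.
have tS i : t i.+1 = t i + N.+1%:R^-1 by rewrite /t -addn1 natrD mulrDl mul1r.
have t0 : t 0%N = 0 by rewrite /t mul0r.
have t1 : t N.+1 = 1 by rewrite /t divff // gt_eqF.
pose l i j := quadrant_label (a (t i) (t j)) (b (t i) (t j)).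
have near i j i' j' : (i <= N.+1)%N -> (j <= N.+1)%N -> (i' <= N.+1)%N ->
    (j' <= N.+1)%N -> (i' == i) || (i' == i.+1) -> (j' == j) || (j' == j.+1) ->
    ~~ opposite (l i j) (l i' j').
  move=> iN jN iN' jN' ii jj; apply/negP.
  have stp k k' : (k' == k) || (k' == k.+1) -> `|t k - t k'| <= N.+1%:R^-1.
    case/orP => /eqP ->; first by rewrite subrr normr0 invr_ge0 ltW.
    by rewrite tS opprD addNKr normrN ger0_norm // invr_ge0 ltW.
  have L0 := lipschitz_on_square_ge0 La.
  have small : L * (`|t i - t i'| + `|t j - t j'|) < 2 * e.
    apply: (@le_lt_trans _ _ (L * (N.+1%:R^-1 + N.+1%:R^-1))).
      by rewrite ler_wpM2l // lerD ?stp.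
    rewrite (_ : L * _ = L * 2 / N.+1%:R); last by ring.
    rewrite ltr_pdivrMr //.
    by apply: lt_le_trans Nbig _; rewrite ler_wpM2r // ?ltW //; lra.
  have Ha := La _ _ _ _ (t01 _ iN) (t01 _ iN') (t01 _ jN) (t01 _ jN').
  have Hb := Lb _ _ _ _ (t01 _ iN) (t01 _ iN') (t01 _ jN) (t01 _ jN').
  case/(opposite_label_far (emin _ _ (t01 _ iN) (t01 _ jN))
                          (emin _ _ (t01 _ iN') (t01 _ jN'))); lra.
apply: (@no_antisymmetric_labelling N.+1 l).
- by move=> i j ij; apply: near; rewrite ?eqxx ?orbT //; lia.
- by move=> i j ij; apply: near; rewrite ?eqxx ?orbT //; lia.
- by move=> i j ij; apply: near; rewrite ?eqxx ?orbT //; lia.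
- by move=> i _; apply: quadrant_label_ge0.
- move=> j _; rewrite /l t1 t0 aC bC aN bN quadrant_labelN //.
Qed.

End CommonZero.

(** * Finite extrema and middle levels *)

Section SeqExtrema.
Variable R : realType.

(** Folding from the head keeps the result among the entries of a nonempty
    sequence, whatever their signs. *)
Definition smax (s : seq R) : R := foldr Num.max (head 0 s) s.
Definition smin (s : seq R) : R := - smax [seq - x | x <- s].

Lemma smax_ge (s : seq R) x : x \in s -> x <= smax s.
Proof.
rewrite /smax; elim: s (head 0 s) => //= y s IH d.
rewrite inE le_max => /orP[/eqP -> | /IH ->]; first by rewrite lexx.
by rewrite orbT.
Qed.

Lemma smax_in (s : seq R) : s != [::] -> smax s \in s.
Proof.
have aux d : foldr Num.max d s \in d :: s.
  elim: s => [|y s IH] /=; first by rewrite mem_head.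
  case: lerP => _; last by rewrite !inE eqxx orbT.
  by move: IH; rewrite !inE => /orP[-> // | ->]; rewrite !orbT.
case: s aux => //= y s /(_ y); rewrite /smax /= => + _.
by rewrite inE => /orP[/eqP -> | //]; rewrite mem_head.
Qed.

Lemma smin_le (s : seq R) x : x \in s -> smin s <= x.
Proof. by move=> xs; rewrite lerNl smax_ge // map_f. Qed.

Lemma smin_in (s : seq R) : s != [::] -> smin s \in s.
Proof.
move=> s0; have : smax [seq - x | x <- s] \in [seq - x | x <- s].
  by apply: smax_in; case: s s0.
by case/mapP => x xs; rewrite /smin => ->; rewrite opprK.
Qed.

Variable T : eqType.
Implicit Types (f g : T -> R) (V : seq T).

Lemma smax_map f V : V != [::] ->
  exists2 x, x \in V & smax (map f V) = f x.
Proof. by move=> V0; apply/mapP; apply: smax_in; case: V V0. Qed.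

Lemma smin_map f V : V != [::] ->
  exists2 x, x \in V & smin (map f V) = f x.
Proof. by move=> V0; apply/mapP; apply: smin_in; case: V V0. Qed.

(** The error e may be negative: with e < 0 these lemmas give the strict growth
    of extrema that makes tilts unique. *)
Lemma smax_mapD f g V e : V != [::] ->
  {in V, forall x, f x <= g x + e} -> smax (map f V) <= smax (map g V) + e.
Proof.
move=> /(smax_map f)[x xV ->] fg; apply: le_trans (fg x xV) _.
by rewrite lerD2r smax_ge // map_f.
Qed.

Lemma smin_mapD f g V e : V != [::] ->
  {in V, forall x, f x <= g x + e} -> smin (map f V) <= smin (map g V) + e.
Proof.
move=> /(smin_map g)[x xV ->] fg; apply: le_trans (fg x xV).
by rewrite smin_le // map_f.
Qed.

Lemma smaxN f V : smax [seq - f x | x <- V] = - smin (map f V).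
Proof. by rewrite /smin opprK -map_comp. Qed.

Lemma sminN f V : smin [seq - f x | x <- V] = - smax (map f V).
Proof.
rewrite /smin -map_comp; congr (- smax _).
by apply: eq_map => x /=; rewrite opprK.
Qed.

End SeqExtrema.

Section MiddleLevel.
Variables (R : realType) (T : eqType).
Implicit Types (f g : T -> R) (V W : seq T) (P : seq (seq T)).

(** In the application P lists the unions of apart pairs of a family.  A level
    of at least lower leaves no such union strictly above it, and a level of at
    most upper leaves none strictly below it, so middle halves the family as soon as
    lower <= upper. *)
Definition lower f P : R := smax [seq smin (map f W) | W <- P].
Definition upper f P : R := smin [seq smax (map f W) | W <- P].
Definition middle f P : R := (lower f P + upper f P) / 2.

Lemma middleD f g P e : P != [::] -> [::] \notin P ->
  {in P, forall W, {in W, forall x, f x <= g x + e}} ->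
  middle f P <= middle g P + e.
Proof.
move=> P0 nP fg.
have W0 W : W \in P -> W != [::] by move=> WP; apply: contraNneq nP => <-.
have h1 : lower f P <= lower g P + e.
  by apply: smax_mapD => // W WP; apply: smin_mapD; [exact: W0 | exact: fg].
have h2 : upper f P <= upper g P + e.
  by apply: smin_mapD => // W WP; apply: smax_mapD; [exact: W0 | exact: fg].
rewrite /middle; lra.
Qed.

Lemma middleN f P : middle (fun x => - f x) P = - middle f P.
Proof.
rewrite /middle /lower /upper.
rewrite (eq_map (fun W => sminN f W)) (eq_map (fun W => smaxN f W)).
by rewrite smaxN sminN -opprD mulNr addrC.
Qed.

Lemma eq_middle f g P : f =1 g -> middle f P = middle g P.
Proof. by move=> /funext ->. Qed.

(** For a nonempty P this amounts to lower <= upper. *)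
Definition interlaced f P :=
  {in P &, forall W W', smin (map f W) <= smax (map f W')}.

Lemma middle_between f P W : P != [::] -> interlaced f P -> W \in P ->
  smin (map f W) <= middle f P <= smax (map f W).
Proof.
move=> P0 il WP.
have lu : lower f P <= upper f P.
  rewrite /lower /upper.
  have [W1 W1P ->] := smax_map (fun W => smin (map f W)) P0.
  have [W2 W2P ->] := smin_map (fun W => smax (map f W)) P0.
  exact: il.
have := smax_ge (map_f (fun W => smin (map f W)) WP).
have := smin_le (map_f (fun W => smax (map f W)) WP).
rewrite -/(lower f P) -/(upper f P) /middle => *; apply/andP; split; lra.
Qed.

End MiddleLevel.

(** * The pencil of halving planes *)

Section Pencil.
Variable R : realType.

Lemma root_of_slope (f : R -> R) (m M : R) : 0 < m ->
  (forall x y, x <= y -> m * (y - x) <= f y - f x <= M * (y - x)) ->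
  exists x, f x = 0.
Proof.
move=> m0 slope.
have Mm : m <= M by have := slope 0 1 ler01; lra.
have cf : continuous f.
  move=> x; apply/cvgrPdist_lt => e e0.
  have d0 : 0 < e / M by rewrite divr_gt0 //; lra.
  near=> y.
  have : ball x (e / M) y by near: y; exact: (@nbhsx_ballx R R^o x _ d0).
  rewrite /ball /=.
  rewrite ltr_pdivlMr; last by lra.
  have [xy|yx] := leP x y.
    rewrite !ler0_norm; last 2 first.
    - by have := slope _ _ xy; nra.
    - by rewrite subr_le0.
    by have := slope _ _ xy; lra.
  rewrite !ger0_norm; last 2 first.
  - by have := slope _ _ (ltW yx); nra.
  - by rewrite subr_ge0 ltW.
  by have := slope _ _ (ltW yx); lra.
(* The slope is at least m, so f changes sign within distance |f 0| / m of 0. *)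
pose c := `|f 0| / m.
have c0 : 0 <= c by rewrite divr_ge0 // ltW.
have mc : m * c = `|f 0| by rewrite mulrC divfK // gt_eqF.
have h1 := slope 0 c c0.
have h2 := slope (- c) 0; rewrite oppr_le0 in h2; have {}h2 := h2 c0.
have n1 := ler_norm (f 0).
have n2 := ler_norm (- f 0); rewrite normrN in n2.
have [|||x _ fx] := @IVT R f (- c) c 0; last by exists x.
- lra.
- exact: continuous_subspaceT.
- rewrite ge_min le_max; apply/andP; split; apply/orP; [left|right]; lra.
Unshelve. all: by end_near. Qed.

Variables (T : eqType) (px py pz : T -> R).
Implicit Types (A B : seq (seq T)).

(** The vector (1 - 2 r, r (1 - r)) never vanishes and goes from (1, 0) to
    (-1, 0), so it serves as the direction of half a turn; s is the tilt. *)
Definition level (r s : R) (x : T) : R :=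
  (1 - 2 * r) * px x + r * (1 - r) * py x - s * pz x.

Lemma finite_bound (s : seq T) (f : T -> R) :
  exists2 M, 0 <= M & {in s, forall x, `|f x| <= M}.
Proof.
case: s => [|x0 s]; first by exists 0.
have n0 : x0 :: s != [::] by [].
exists (smax [seq `|f x| | x <- x0 :: s]).
  by case: (smax_map (fun x => `|f x|) n0) => x _ ->.
by move=> x xs; apply: smax_ge; exact: (map_f (fun x => `|f x|)).
Qed.

Lemma finite_gap (s : seq T) (f : T -> R) : {in s, forall x, 0 < f x} ->
  exists2 m, 0 < m & {in s, forall x, m <= f x}.
Proof.
case: s => [|x0 s] fs; first by exists 1.
have n0 : x0 :: s != [::] by [].
exists (smin [seq f x | x <- x0 :: s]).
  by case: (smin_map f n0) => x /fs + ->.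
by move=> x xs; apply: smin_le; exact: map_f.
Qed.

(** The difference of the middle levels of A and B is strictly increasing in the
    tilt s, with slope at least 2 m when the third coordinates have absolute
    value at least m.  Hence it has a unique root s r; uniqueness gives the
    antisymmetry, and the lower bound on the slope turns the Lipschitz dependence
    of the levels on r into one of the root. *)
Lemma bisecting_pencil A B :
  A != [::] -> B != [::] -> [::] \notin A -> [::] \notin B ->
  {in A, forall V, {in V, forall x, pz x < 0}} ->
  {in B, forall V, {in V, forall x, 0 < pz x}} ->
  exists (s t : R -> R) (C : R), [/\
    forall r, middle (level r (s r)) A = t r /\ middle (level r (s r)) B = t r,
    s 1 = - s 0, t 1 = - t 0 &
    forall r r', 0 <= r <= 1 -> 0 <= r' <= 1 ->
      `|s r - s r'| <= C * `|r - r'| /\ `|t r - t r'| <= C * `|r - r'|].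
Proof.
move=> A0 B0 nA nB Az Bz.
have [m m0 [mA mB]] : exists2 m, 0 < m &
    {in A, forall V, {in V, forall x, m <= - pz x}} /\
    {in B, forall V, {in V, forall x, m <= pz x}}.
  have [|m m0 mA] := @finite_gap (flatten A) (fun x => - pz x).
    by move=> x /flattenP[V /Az zV /zV]; rewrite oppr_gt0.
  have [|m' m'0 mB] := @finite_gap (flatten B) pz.
    by move=> x /flattenP[V /Bz zV /zV].
  exists (Num.min m m'); first by rewrite lt_min m0.
  split=> V VA x xV; rewrite ge_min.
    by rewrite mA //; apply/flattenP; exists V.
  by rewrite mB ?orbT //; apply/flattenP; exists V.
have [M M0 [Mx My Mz]] : exists2 M, 0 <= M & [/\
    {in A ++ B, forall V, {in V, forall x, `|px x| <= M}},
    {in A ++ B, forall V, {in V, forall x, `|py x| <= M}} &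
    {in A ++ B, forall V, {in V, forall x, `|pz x| <= M}}].
  have [M1 M10 h1] := finite_bound (flatten (A ++ B)) px.
  have [M2 M20 h2] := finite_bound (flatten (A ++ B)) py.
  have [M3 M30 h3] := finite_bound (flatten (A ++ B)) pz.
  exists (M1 + M2 + M3); first by rewrite !addr_ge0.
  split=> V VA x xV; have xf : x \in flatten (A ++ B) by apply/flattenP; exists V.
  - by have := h1 x xf; lra.
  - by have := h2 x xf; lra.
  - by have := h3 x xf; lra.
pose D r s := middle (level r s) A - middle (level r s) B.
have Dslope r s s' : s <= s' ->
    2 * m * (s' - s) <= D r s' - D r s <= 2 * M * (s' - s).
  move=> ss'; rewrite -subr_ge0 in ss'.
  have a1 : middle (level r s) A <= middle (level r s') A + - (m * (s' - s)).
    apply: middleD => // V VA x xV; have := mA V VA x xV.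
    rewrite /level; nra.
  have a2 : middle (level r s') A <= middle (level r s) A + M * (s' - s).
    apply: middleD => // V VA x xV; have := Mz V _ x xV.
    rewrite mem_cat VA => /(_ isT); rewrite ler_norml /level => /andP[? ?]; nra.
  have b1 : middle (level r s') B <= middle (level r s) B + - (m * (s' - s)).
    apply: middleD => // V VA x xV; have := mB V VA x xV.
    rewrite /level; nra.
  have b2 : middle (level r s) B <= middle (level r s') B + M * (s' - s).
    apply: middleD => // V VA x xV; have := Mz V _ x xV.
    rewrite mem_cat VA orbT => /(_ isT); rewrite ler_norml /level => /andP[? ?]; nra.
  rewrite /D; apply/andP; split; lra.
have Dgap r s s' : 2 * m * `|s - s'| <= `|D r s - D r s'|.
  wlog ss' : s s' / s <= s'.
    by move=> wl; case: (leP s s') => [/wl //|/ltW/wl]; rewrite distrC (distrC (D r s)).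
  rewrite (distrC s) (distrC (D r s)) ger0_norm ?subr_ge0 //.
  apply: le_trans (ler_norm _).
  by case/andP: (Dslope r _ _ ss').
have [s sP] : {s : R -> R & forall r, D r (s r) = 0}.
  apply: (@choice _ _ (fun r u => D r u = 0)) => r.
  apply: (@root_of_slope _ (2 * m) (2 * M)); first by lra.
  by move=> x y; exact: Dslope.
(* On [0, 1] the two coefficients of level that depend on r have Lipschitz
   constants 2 and 1, whence the factor 3. *)
have levelr (P : seq (seq T)) r r' u :
    {subset P <= A ++ B} -> P != [::] -> [::] \notin P ->
    0 <= r <= 1 -> 0 <= r' <= 1 ->
    `|middle (level r u) P - middle (level r' u) P| <= 3 * M * `|r - r'|.
  move=> PAB P0 nP rI rI'.
  have h q q' : 0 <= q <= 1 -> 0 <= q' <= 1 ->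
      middle (level q u) P <= middle (level q' u) P + 3 * M * `|q - q'|.
    move=> qI qI'; apply: middleD => // V /PAB VP x xV.
    have := Mx V VP x xV; have := My V VP x xV; rewrite /level.
    have e1 : (1 - 2 * q) * px x <= (1 - 2 * q') * px x + 2 * `|q - q'| * `|px x|.
      have := ler_norm ((q' - q) * px x); rewrite normrM (distrC q'); lra.
    have e2 : q * (1 - q) * py x <= q' * (1 - q') * py x + `|q - q'| * `|py x|.
      have := ler_norm ((q - q') * (1 - q - q') * py x); rewrite !normrM.
      have : `|1 - q - q'| <= 1 by rewrite ler_norml; lra.
      have := normr_ge0 (q - q'); have := normr_ge0 (py x).
      move=> g1 g2 /(ler_wpM2l (mulr_ge0 g2 g1)); lra.
    have := normr_ge0 (q - q'); nra.
  rewrite ler_norml; have := h _ _ rI rI'; have := h _ _ rI' rI.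
  rewrite (distrC r'); lra.
have Asub : {subset A <= A ++ B} by move=> V; rewrite mem_cat => ->.
have Bsub : {subset B <= A ++ B} by move=> V; rewrite mem_cat orbC => ->.
pose t r := middle (level r (s r)) A.
have sLip r r' : 0 <= r <= 1 -> 0 <= r' <= 1 ->
    m * `|s r - s r'| <= 3 * M * `|r - r'|.
  move=> rI rI'.
  have := Dgap r (s r) (s r'); rewrite sP -{1}(sP r') /D.
  have := levelr A r r' (s r') Asub A0 nA rI rI'.
  have := levelr B r r' (s r') Bsub B0 nB rI rI'.
  rewrite !ler_norml -/(D r' (s r')) -/(D r (s r')) => /andP[? ?] /andP[? ?].
  move=> /le_trans h; suff : 2 * m * `|s r - s r'| <= 2 * (3 * M * `|r - r'|) by lra.
  by apply: h; rewrite ler_norml /D; apply/andP; split; lra.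
have tLip r r' : 0 <= r <= 1 -> 0 <= r' <= 1 ->
    `|t r - t r'| <= M * `|s r - s r'| + 3 * M * `|r - r'|.
  move=> rI rI'.
  have h u u' : middle (level r' u) A <= middle (level r' u') A + M * `|u - u'|.
    apply: middleD => // V /Asub VP x xV; have := Mz V VP x xV; rewrite /level.
    have := ler_norm ((u' - u) * pz x); rewrite normrM (distrC u').
    have := normr_ge0 (u - u'); nra.
  have := levelr A r r' (s r) Asub A0 nA rI rI'; rewrite !ler_norml.
  have := h (s r) (s r'); have := h (s r') (s r); rewrite (distrC (s r')) /t; lra.
have opp u x : level 1 (- u) x = - level 0 u x by rewrite /level; ring.
have Mopp u P : middle (level 1 (- u)) P = - middle (level 0 u) P.
  by rewrite (eq_middle _ (opp u)) middleN.
have s1 : s 1 = - s 0.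
  apply/eqP; rewrite -subr_eq0 -normr_le0.
  have := Dgap 1 (s 1) (- s 0); rewrite sP.
  have -> : D 1 (- s 0) = 0 by have := sP 0; rewrite /D !Mopp; lra.
  rewrite subrr normr0 pmulr_rle0 //; lra.
exists s, t, (M * (3 * M / m) + 3 * M + 3 * M / m); split => //.
- by move=> r; split => //; have := sP r; rewrite /D /t; lra.
- by rewrite /t s1 Mopp.
move=> r r' rI rI'.
have h1 : `|s r - s r'| <= 3 * M / m * `|r - r'|.
  by rewrite mulrAC ler_pdivlMr // mulrC sLip.
have h2 := tLip r r' rI rI'.
have n0 := normr_ge0 (r - r').
have K0 : 0 <= 3 * M / m by rewrite divr_ge0 ?mulr_ge0 // ltW.
have h3 := ler_wpM2l M0 h1.
have h4 := mulr_ge0 M0 n0; have h5 := mulr_ge0 K0 n0.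
have h6 := mulr_ge0 M0 h5.
split; lra.
Qed.

End Pencil.

(** * Members of a family in the quadrants of two functions *)

Section Quadrants.
Variables (R : realType) (T : eqType).
Implicit Types (f g : T -> R) (V W : seq T) (A : seq (seq T)).

Definition pos f V := all (fun x => 0 < f x) V.

Definition hit f V := ~~ pos f V && ~~ pos (\- f) V.

(** D stands for the relation of being separated. *)
Definition halving (D : rel (seq T)) f A :=
  {in A &, forall V W, D V W ->
    ~~ (pos f V && pos f W) /\ ~~ (pos (\- f) V && pos (\- f) W)}.

Definition separates (D : rel (seq T)) f :=
  forall V W, pos f V -> pos (\- f) W -> D V W.

(** How far inside the region 0 < f the deepest member of A lies; the leading 0
    makes the depth vanish exactly when no member is contained in the region, if the members are nonempty. *)
Definition depth f A : R := smax (0 :: [seq smin (map f V) | V <- A]).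

Lemma depth_ge0 f A : 0 <= depth f A.
Proof. by apply: smax_ge; rewrite mem_head. Qed.

Lemma depth_gt0P f A : [::] \notin A ->
  reflect (exists2 V, V \in A & pos f V) (0 < depth f A).
Proof.
move=> nA; apply: (iffP idP) => [d0|[V VA fV]].
  have : depth f A \in 0 :: [seq smin (map f V) | V <- A] by apply: smax_in.
  rewrite inE => /orP[/eqP dA|/mapP[V VA dV]]; first by rewrite dA ltxx in d0.
  exists V => //; apply/allP => x xV; apply: lt_le_trans d0 _.
  by rewrite dV; apply: smin_le; exact: map_f.
have V0 : V != [::] by apply: contraNneq nA => <-.
have [x xV fx] := smin_map f V0; have /allP/(_ x xV) := fV; rewrite -fx.
move=> /lt_le_trans; apply; apply: smax_ge.
by rewrite inE (map_f (fun V => smin (map f V)) VA) orbT.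
Qed.

Lemma depthD f g A e : [::] \notin A -> 0 <= e ->
  {in A, forall V, {in V, forall x, f x <= g x + e}} ->
  depth f A <= depth g A + e.
Proof.
move=> nA e0 fg.
have : depth f A \in 0 :: [seq smin (map f V) | V <- A] by apply: smax_in.
rewrite inE => /orP[/eqP ->|/mapP[V VA ->]].
  by rewrite addr_ge0 ?depth_ge0.
have V0 : V != [::] by apply: contraNneq nA => <-.
apply: le_trans (smin_mapD V0 (fg V VA)) _; rewrite lerD2r; apply: smax_ge.
by rewrite inE (map_f (fun V => smin (map g V)) VA) orbT.
Qed.

Definition wedge f g (x : T) : R := Num.min (f x) (g x).

Lemma wedgeC f g : wedge f g = wedge g f.
Proof. by apply/funext => x; rewrite /wedge minC. Qed.

Lemma pos_wedge f g V : pos (wedge f g) V = pos f V && pos g V.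
Proof. by rewrite -all_predI; apply: eq_all => x /=; rewrite lt_min. Qed.

(** The depth of A in the quadrants where f and g have equal signs, minus its
    depth in those where the signs differ. *)
Definition skew A f g : R :=
  Num.max (depth (wedge f g) A) (depth (wedge (\- f) (\- g)) A) -
  Num.max (depth (wedge f (\- g)) A) (depth (wedge (\- f) g) A).

Lemma skewC A f g : skew A f g = skew A g f.
Proof.
rewrite /skew; congr (_ - _); first by rewrite wedgeC (wedgeC (\- f)).
by rewrite maxC (wedgeC f) (wedgeC (\- f)).
Qed.

Lemma oppfK f : \- (\- f) = f.
Proof. by apply/funext => x /=; rewrite opprK. Qed.

Lemma skewN A f g : skew A (\- f) g = - skew A f g.
Proof. by rewrite /skew oppfK opprB maxC [X in _ - X]maxC. Qed.

(** The quadrants of f and - f are empty. *)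
Lemma skew_diag A f : [::] \notin A -> 0 <= skew A f f.
Proof.
move=> nA.
have opp (h : T -> R) : depth (wedge h (\- h)) A <= 0.
  rewrite leNgt; apply/negP => /(depth_gt0P _ nA)[[|x V] VA].
    by rewrite VA in nA.
  rewrite pos_wedge /= oppr_gt0 => /andP[/andP[h1 _] /andP[h2 _]].
  by have := lt_trans h1 h2; rewrite ltxx.
rewrite /skew subr_ge0 (wedgeC (\- f) f) maxxx (le_trans (opp f)) //.
by rewrite le_max depth_ge0.
Qed.

Lemma max_leD (a b a' b' e : R) : a <= a' + e -> b <= b' + e ->
  Num.max a b <= Num.max a' b' + e.
Proof.
move=> aa bb; rewrite ge_max; apply/andP; split.
  by apply: le_trans aa _; rewrite lerD2r le_max lexx.
by apply: le_trans bb _; rewrite lerD2r le_max lexx orbT.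
Qed.

Lemma min_leD (a b a' b' e : R) : a <= a' + e -> b <= b' + e ->
  Num.min a b <= Num.min a' b' + e.
Proof.
move=> aa bb; rewrite -lerBlDr le_min !lerBlDr; apply/andP; split.
  by apply: le_trans aa; rewrite ge_min lexx.
by apply: le_trans bb; rewrite ge_min lexx orbT.
Qed.

Definition close_on A e f g :=
  {in A, forall V, {in V, forall x, `|f x - g x| <= e}}.

Lemma close_onN A e f g : close_on A e f g -> close_on A e (\- f) (\- g).
Proof. by move=> fg V VA x xV /=; rewrite -opprD normrN; exact: (fg V VA x xV). Qed.

Lemma close_onC A e f g : close_on A e f g -> close_on A e g f.
Proof. by move=> fg V VA x xV; rewrite distrC; exact: (fg V VA x xV). Qed.

Lemma depth_wedgeD A f g f' g' e : [::] \notin A -> 0 <= e ->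
  close_on A e f f' -> close_on A e g g' ->
  depth (wedge f g) A <= depth (wedge f' g') A + e.
Proof.
move=> nA e0 ff' gg'; apply: depthD => // V VA x xV.
have := ff' V VA x xV; have := gg' V VA x xV; rewrite !ler_distl.
by move=> /andP[_ gle] /andP[_ fle]; exact: min_leD.
Qed.

Lemma skewD A f g f' g' e : [::] \notin A -> 0 <= e ->
  close_on A e f f' -> close_on A e g g' ->
  `|skew A f g - skew A f' g'| <= 2 * e.
Proof.
move=> nA e0.
have half (h k h' k' : T -> R) : close_on A e h h' -> close_on A e k k' ->
    skew A h k <= skew A h' k' + 2 * e.
  move=> hh kk; have hC := close_onC hh; have kC := close_onC kk.
  have m1 := max_leD (depth_wedgeD nA e0 hh kk)
                     (depth_wedgeD nA e0 (close_onN hh) (close_onN kk)).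
  have m2 := max_leD (depth_wedgeD nA e0 hC (close_onN kC))
                     (depth_wedgeD nA e0 (close_onN hC) kC).
  rewrite /skew; lra.
move=> ff gg; have := half _ _ _ _ ff gg.
have := half _ _ _ _ (close_onC ff) (close_onC gg).
by rewrite ler_norml => *; apply/andP; split; lra.
Qed.

(** Members V and W in adjacent quadrants are separated by one of the functions
    and are on the same side of the other, contradicting halving.  So one of the
    two terms of skew is 0, and skew = 0 forces all four depths to be 0. *)
Lemma hit_of_skew0 (D : rel (seq T)) A f g :
  [::] \notin A -> separates D f -> separates D g ->
  halving D f A -> halving D g A -> skew A f g = 0 ->
  {in A, forall V, hit f V || hit g V}.
Proof.
move=> nA sf sg hf hg /eqP; rewrite subr_eq0 => /eqP skew0.
set a := Num.max _ _ in skew0.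
have a0 : a <= 0.
  rewrite leNgt; apply/negP => apos; have := apos; rewrite skew0.
  rewrite lt_max => /orP bpos; move: apos; rewrite lt_max => /orP apos.
  case: apos => /(depth_gt0P _ nA)[V VA]; rewrite pos_wedge => /andP[fV gV];
  case: bpos => /(depth_gt0P _ nA)[W WA]; rewrite pos_wedge => /andP[fW gW].
  - by case: (hf V W VA WA (sg _ _ gV gW)); rewrite fV fW.
  - by case: (hg V W VA WA (sf _ _ fV fW)); rewrite gV gW.
  - by case: (hg W V WA VA (sf _ _ fW fV)) => _; rewrite gV gW.
  - by case: (hf W V WA VA (sg _ _ gW gV)) => _; rewrite fV fW.
have none (h k : T -> R) V :
    V \in A -> pos h V -> pos k V -> depth (wedge h k) A <= 0 -> False.
  move=> VA hV kV; rewrite leNgt => /negP; apply; apply/(depth_gt0P _ nA).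
  by exists V; rewrite // pos_wedge hV.
move=> V VA; apply/negPn/negP; rewrite negb_or !negb_and !negbK.
move: (a0); rewrite ge_max => /andP[d1 d2].
move: a0; rewrite skew0 ge_max => /andP[d3 d4].
by case/andP => /orP[fV|fV] /orP[gV|gV];
  apply: (none _ _ V VA fV gV).
Qed.

End Quadrants.

(** * Separated families of point sets in space *)

Section Space.
Variable R : realType.
Notation point := 'rV[R]_3.
Implicit Types (V W : seq point) (A B F : seq (seq point)) (u : point).

Definition affine u (d : R) (x : point) : R :=
  \sum_(i < 3) u ord0 i * x ord0 i - d.

Definition apart V W : bool :=
  `[< exists u d, pos (affine u d) V /\ pos (\- affine u d) W >].

Lemma apart_separates u d : separates apart (affine u d).
Proof. by move=> V W fV fW; apply/asboolP; exists u, d. Qed.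

(** Repetitions in s are harmless: a nonempty point set is not apart from
    itself. *)
Definition packing A k :=
  exists s, [/\ size s = k, {subset s <= A} & pairwise apart s].

Lemma pos_subD u d e V :
  pos (affine u (d + e)) V = all (fun x => e < affine u d x) V.
Proof. by apply: eq_all => x; rewrite /affine opprD addrA subr_gt0. Qed.

Lemma pos_opp_subD u d e V :
  pos (\- affine u (d + e)) V = all (fun x => affine u d x < e) V.
Proof. by apply: eq_all => x /=; rewrite /affine oppr_gt0 opprD addrA subr_lt0. Qed.

Lemma packing_separated A B F k l u d :
  packing A k -> packing B l -> {subset A <= F} -> {subset B <= F} ->
  {in A, forall V, pos (affine u d) V} ->
  {in B, forall V, pos (\- affine u d) V} -> packing F (k + l).
Proof.
move=> [s [<- sA ps]] [s' [<- sB ps']] AF BF fA fB; exists (s ++ s'); split.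
- by rewrite size_cat.
- by move=> V; rewrite mem_cat => /orP[/sA/AF|/sB/BF].
rewrite pairwise_cat ps ps' !andbT; apply/allrelP => V W /sA VA /sB WB.
by apply: (@apart_separates u d); [exact: fA | exact: fB].
Qed.

(** If a plane separated two unions of apart pairs, the four sets would be
    pairwise apart; this is where the bound on packings is used.  When there are
    no apart pairs every plane halves A, and the single point x0 provides a
    nonempty list P with the same properties. *)
Lemma apart_unions A (Q : point -> Prop) x0 :
  ~ packing A 4 -> [::] \notin A -> Q x0 ->
  {in A, forall V, {in V, forall x, Q x}} ->
  exists P, [/\ P != [::], [::] \notin P,
    {in P, forall W, {in W, forall x, Q x}},
    forall u d, interlaced (affine u d) P &
    {in A &, forall V W, apart V W -> V ++ W \in P}].
Proof.
move=> nu3 nA Qx0 QA.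
pose P := [seq p.1 ++ p.2 | p <- allpairs pair A A & apart p.1 p.2].
have PP W : W \in P ->
    exists V1 V2, [/\ V1 \in A, V2 \in A, apart V1 V2 & W = V1 ++ V2].
  case/mapP => -[V1 V2]; rewrite mem_filter /=.
  move=> /andP[ap /allpairsP[[X Y] /= [XA YA [e1 e2]]]] ->.
  by exists V1, V2; rewrite e1 e2; split=> //; rewrite -e1 -e2.
have inP V W : V \in A -> W \in A -> apart V W -> V ++ W \in P.
  move=> VA WA ap; apply/mapP; exists (V, W) => //.
  by rewrite mem_filter /= ap; apply/allpairsP; exists (V, W).
have [P0|P0] := eqVneq P [::].
  exists [:: [:: x0]]; split=> //.
  - by move=> W; rewrite inE => /eqP -> x; rewrite inE => /eqP ->.
  - move=> u d W W'; rewrite !inE => /eqP -> /eqP ->; rewrite /smin /smax /=.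
    by rewrite !maxxx opprK.
  - by move=> V W VA WA /(inP _ _ VA WA); rewrite P0.
exists P; split=> //.
- by apply/negP => /PP[V1 [V2 [V1A _ _]]]; case: V1 V1A nA => // ->.
- move=> W /PP[V1 [V2 [V1A V2A _ ->]]] x; rewrite mem_cat.
  by case/orP; apply: QA.
move=> u d W W' WP W'P; rewrite leNgt; apply/negP => gap; apply: nu3.
set f := affine u d in gap.
pose e := (smin (map f W) + smax (map f W')) / 2.
have [V1 [V2 [V1A V2A ap Wdef]]] := PP _ WP.
have [V3 [V4 [V3A V4A ap' W'def]]] := PP _ W'P.
have fW : pos (affine u (d + e)) W.
  rewrite pos_subD; apply/allP => x xW.
  have := smin_le (map_f f xW); rewrite /e -/f; lra.
have fW' : pos (\- affine u (d + e)) W'.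
  rewrite pos_opp_subD; apply/allP => x xW.
  have := smax_ge (map_f f xW); rewrite /e -/f; lra.
move: fW fW'; rewrite Wdef W'def /pos !all_cat => /andP[f1 f2] /andP[f3 f4].
apply: (@packing_separated [:: V1; V2] [:: V3; V4] A 2 2 u (d + e)).
- by exists [:: V1; V2]; split; rewrite /= ?ap.
- by exists [:: V3; V4]; split; rewrite /= ?ap'.
- by move=> V; rewrite !inE => /orP[] /eqP ->.
- by move=> V; rewrite !inE => /orP[] /eqP ->.
- by move=> V; rewrite !inE => /orP[] /eqP ->.
- by move=> V; rewrite !inE => /orP[] /eqP ->.
Qed.

Lemma middle_halving A P u d e :
  P != [::] -> interlaced (affine u d) P ->
  {in A &, forall V W, apart V W -> V ++ W \in P} ->
  middle (affine u d) P = e -> [::] \notin A ->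
  halving apart (affine u (d + e)) A.
Proof.
move=> P0 il AP <- nA V W VA WA /(AP _ _ VA WA) VWP.
have VW0 : V ++ W != [::] by case: V VA {VWP} => //= VA; rewrite VA in nA.
have /andP[lo hi] := middle_between P0 il VWP.
rewrite !pos_subD !pos_opp_subD -!all_cat; split; apply/negP => /allP all1.
  have [x xVW fx] := smin_map (affine u d) VW0.
  by have := all1 x xVW; rewrite -fx ltNge lo.
have [x xVW fx] := smax_map (affine u d) VW0.
by have := all1 x xVW; rewrite -fx ltNge hi.
Qed.

Definition crd (k : nat) (x : point) : R := x ord0 (inord k).

Lemma affine_coordinates (a b c d : R) : exists2 u : point,
  forall x, affine u d x = a * crd 0 x + b * crd 1 x + c * crd 2 x - d &
  [|| a != 0, b != 0 | c != 0] -> u != 0.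
Proof.
exists (\row_i [:: a; b; c]`_i) => [x|].
  rewrite /affine /crd !big_ord_recl big_ord0 addr0 !mxE /= -!addrA.
  by do !congr (_ * x ord0 _ + _); apply/val_inj; rewrite /= inordK.
apply: contraTneq => /rowP u0.
have := u0 (inord 0); have := u0 (inord 1); have := u0 (inord 2).
by rewrite !mxE !inordK //= => -> -> ->; rewrite eqxx.
Qed.

(** The zero of the two skews given by common_zero along the pencil of halving
    planes yields a pair of planes that meets every member of A and of B. *)
Lemma two_planes A B (c : R) :
  ~ packing A 4 -> ~ packing B 4 -> [::] \notin A -> [::] \notin B ->
  {in A, forall V, {in V, forall x, crd 2 x < c}} ->
  {in B, forall V, {in V, forall x, c < crd 2 x}} ->
  exists u d u' d', [/\ u != 0, u' != 0 &
    {in A ++ B, forall V, hit (affine u d) V || hit (affine u' d') V}].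
Proof.
move=> nu3A nu3B nA nB Az Bz; pose pz x := crd 2 x - c.
have [xm xmz] : exists x, pz x < 0.
  exists (const_mx (c - 1)); rewrite /pz /crd mxE; lra.
have [xp xpz] : exists x, 0 < pz x.
  exists (const_mx (c + 1)); rewrite /pz /crd mxE; lra.
have [|PA [PA0 nPA PAz PAi PAA]] :=
    @apart_unions A (fun x => pz x < 0) _ nu3A nA xmz.
  by move=> V VA x xV; rewrite subr_lt0; exact: Az VA x xV.
have [|PB [PB0 nPB PBz PBi PBB]] :=
    @apart_unions B (fun x => 0 < pz x) _ nu3B nB xpz.
  by move=> V VA x xV; rewrite subr_gt0; exact: Bz VA x xV.
have [s [t [C [st s1 t1 Lip]]]] :=
  @bisecting_pencil R _ (crd 0) (crd 1) pz PA PB PA0 PB0 nPA nPB PAz PBz.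
pose h r x := level (crd 0) (crd 1) pz r (s r) x - t r.
have haff r : exists2 u : point, u != 0 &
    exists2 d, level (crd 0) (crd 1) pz r (s r) = affine u d & h r = affine u (d + t r).
  have [u uE u0] := affine_coordinates (1 - 2 * r) (r * (1 - r)) (- s r) (- (s r * c)).
  exists u; last exists (- (s r * c)).
  - apply: u0; apply/orP; have [r2|] := eqVneq (1 - 2 * r) 0; [right|by left].
    by apply/orP; left; apply/eqP; nra.
  - by apply/funext => x; rewrite uE /level /pz; ring.
  - apply/funext => x; rewrite /affine opprD addrA -/(affine u _ x) uE.
    by rewrite /h /level /pz; ring.
have hsep r : separates apart (h r).
  by have [u _ [d _ ->]] := haff r; exact: apart_separates.
have hA r : halving apart (h r) A.
  have [u _ [d lE ->]] := haff r; apply: middle_halving PA0 (PAi u d) PAA _ nA.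
  by rewrite -lE; case: (st r).
have hB r : halving apart (h r) B.
  have [u _ [d lE ->]] := haff r; apply: middle_halving PB0 (PBi u d) PBB _ nB.
  by rewrite -lE; case: (st r).
have h1 : h 1 = \- h 0.
  by apply/funext => x; rewrite /h /level s1 t1 /=; ring.
have [L L0 hLip] : exists2 L, 0 <= L & forall r r', 0 <= r <= 1 -> 0 <= r' <= 1 ->
    {in A ++ B, forall V, {in V, forall x, `|h r x - h r' x| <= L * `|r - r'|}}.
  (* h is Lipschitz in r, uniformly over the finitely many vertices. *)
  have [M M0 Mb] := finite_bound (flatten (A ++ B))
    (fun x => `|crd 0 x| + `|crd 1 x| + `|pz x|).
  exists (2 * M + `|C| * M + `|C|); first by rewrite !addr_ge0 ?mulr_ge0.
  move=> r r' rI rI' V VAB x xV; have [sL tL] := Lip _ _ rI rI'.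
  have xf : x \in flatten (A ++ B) by apply/flattenP; exists V.
  have := le_trans (ler_norm _) (Mb x xf).
  have := normr_ge0 (crd 0 x); have := normr_ge0 (crd 1 x); have := normr_ge0 (pz x).
  set X := `|crd 0 x|; set Y := `|crd 1 x|; set Z := `|pz x| => Z0 Y0 X0 XYZ.
  have n0 := normr_ge0 (r - r').
  have CC : C * `|r - r'| <= `|C| * `|r - r'| by rewrite ler_wpM2r // ler_norm.
  have -> : h r x - h r' x = - 2 * (r - r') * crd 0 x +
      ((r - r') * (1 - r - r') * crd 1 x + (- (s r - s r') * pz x - (t r - t r'))).
    by rewrite /h /level; ring.
  apply: le_trans (ler_normD _ _) _; apply: le_trans (lerD (lexx _) (ler_normD _ _)) _.
  apply: le_trans (lerD (lexx _) (lerD (lexx _) (ler_normB _ _))) _.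
  rewrite !normrM !normrN -/X -/Y -/Z (@ger0_norm _ 2) //.
  have r1 : `|1 - r - r'| <= 1 by rewrite ler_norml; lra.
  have e2 : `|r - r'| * `|1 - r - r'| * Y <= `|r - r'| * Y.
    by rewrite ler_wpM2r // -[leRHS]mulr1 ler_wpM2l.
  have e3 : `|s r - s r'| * Z <= `|C| * `|r - r'| * Z.
    by rewrite ler_wpM2r // (le_trans sL).
  have e4 : `|r - r'| * (2 * X + Y) <= `|r - r'| * (2 * M) by rewrite ler_wpM2l //; lra.
  have e5 : `|C| * `|r - r'| * Z <= `|C| * `|r - r'| * M.
    by rewrite ler_wpM2l ?mulr_ge0 //; lra.
  lra.
have skewLip G : {subset G <= A ++ B} -> [::] \notin G ->
    lipschitz_on_square (2 * L) (fun r r' => skew G (h r) (h r')).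
  move=> GAB nG x x' y y' xI xI' yI yI'.
  have n1 := normr_ge0 (x - x'); have n2 := normr_ge0 (y - y').
  rewrite -mulrA; apply: skewD => //.
  - by rewrite mulr_ge0 ?addr_ge0.
  - move=> V /GAB VG p pV; apply: le_trans (hLip _ _ xI xI' V VG p pV) _.
    by rewrite ler_wpM2l // lerDl.
  - move=> V /GAB VG p pV; apply: le_trans (hLip _ _ yI yI' V VG p pV) _.
    by rewrite ler_wpM2l // lerDr.
have Asub : {subset A <= A ++ B} by move=> V; rewrite mem_cat => ->.
have Bsub : {subset B <= A ++ B} by move=> V; rewrite mem_cat orbC => ->.
have [||||||r [r' [Ar Br]]] :=
    common_zero (skewLip A Asub nA) (skewLip B Bsub nB).
- by move=> r r'; exact: skewC.
- by move=> r r'; exact: skewC.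
- by move=> r; rewrite h1 skewN.
- by move=> r; rewrite h1 skewN.
- by move=> r; exact: skew_diag.
- by move=> r; exact: skew_diag.
have [u u0 [d _ hE]] := haff r; have [u' u'0 [d' _ hE']] := haff r'.
exists u, (d + t r), u', (d' + t r'); split=> // V; rewrite -hE -hE' mem_cat.
by case/orP; [move: V; exact: hit_of_skew0 Ar | move: V; exact: hit_of_skew0 Br].
Qed.

End Space.

Section SpaceSplit.
Variable R : realType.
Notation point := 'rV[R]_3.
Implicit Types (V W : seq point) (A F s : seq (seq point)) (u : point).

Lemma packing_sub A F k : {subset A <= F} -> packing A k -> packing F k.
Proof. by move=> AF [s [ks sA ps]]; exists s; split=> // V /sA/AF. Qed.

Definition below (c : R) F := [seq V <- F | all (fun x => crd 2 x < c) V].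
Definition upto (c : R) F := [seq V <- F | all (fun x => crd 2 x <= c) V].
Definition above (c : R) F := [seq V <- F | all (fun x => c < crd 2 x) V].

Lemma horizontal (c : R) : exists2 u, u != 0 & forall x, affine u c x = crd 2 x - c.
Proof.
have [u uE u0] := affine_coordinates 0 0 1 c.
exists u; first by rewrite u0 ?oner_eq0 ?orbT.
by move=> x; rewrite uE !mul0r !add0r mul1r.
Qed.

(** If four members are pairwise apart, take the smallest height c such that four
    pairwise apart members lie weakly below it.  By minimality no four such
    members lie strictly below c; four of them strictly above c would complete
    those below to eight. *)
Lemma balanced_cut F : [::] \notin F -> ~ packing F 8 ->
  exists c, ~ packing (below c F) 4 /\ ~ packing (above c F) 4.
Proof.
move=> nF nu7.
have subf (p : pred (seq point)) : {subset [seq V <- F | p V] <= F}.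
  by move=> V; rewrite mem_filter => /andP[].
have [F4|nF4] := pselect (packing F 4); last first.
  by exists 0; split=> /(packing_sub (subf _)).
pose top V := smax (map (crd 2) V).
have topP V : V != [::] -> forall c, all (fun x => crd 2 x <= c) V = (top V <= c).
  move=> V0 c; apply/allP/idP => [Vc|Vc x xV].
    by rewrite /top; have [x xV ->] := smax_map (crd 2) V0; exact: Vc.
  by apply: le_trans Vc; apply: smax_ge; exact: map_f.
have ne V : V \in F -> V != [::] by move=> VF; apply: contraNneq nF => <-.
pose cs := [seq c <- map top F | `[< packing (upto c F) 4 >]].
have csP s : size s = 4 -> {subset s <= F} -> pairwise (@apart R) s ->
    smax (map top s) \in cs.
  move=> s4 sF ps; have s0 : s != [::] by case: s s4 {sF ps}.
  have [V Vs tV] := smax_map top s0.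
  rewrite mem_filter tV map_f ?sF // andbT; apply/asboolP; exists s; split=> // W Ws.
  rewrite mem_filter sF // andbT topP ?ne ?sF // -tV.
  by apply: smax_ge; exact: map_f.
have cs0 : cs != [::].
  by case: F4 => s [s4 sF ps]; apply: contraTneq (csP s s4 sF ps) => ->.
have := smin_in cs0; set c := smin cs; rewrite mem_filter => /andP[/asboolP c4 _].
exists c; split=> -[s [s4 sc ps]].
  have sF : {subset s <= F} by move=> V /sc; exact: subf.
  have s0 : s != [::] by case: s s4 {sF ps sc}.
  have := smin_le (csP s s4 sF ps); have [V Vs ->] := smax_map top s0.
  rewrite /top; have [x xV ->] := smax_map (crd 2) (ne V (sF V Vs)).
  move: (sc V Vs); rewrite mem_filter => /andP[/allP/(_ x xV) xc _].
  by rewrite leNgt xc.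
have [|m m0 mP] := @finite_gap R _ (flatten s) (fun x => crd 2 x - c).
  move=> x /flattenP[V /sc]; rewrite mem_filter => /andP[/allP Vc _] xV.
  by rewrite subr_gt0 Vc.
(* The members of s stay at distance m above height c, so the plane at height
   c + m / 2 separates them from those weakly below c. *)
have [u _ uE] := horizontal (c + m / 2); apply: nu7.
apply: (@packing_separated _ s (upto c F) F 4 4 u (c + m / 2)) => //.
- by exists s; split.
- by move=> V /sc; exact: subf.
- exact: subf.
- move=> V Vs; apply/allP => x xV; rewrite uE.
  have := mP x _; rewrite (_ : x \in flatten s) => [/(_ isT)|]; first lra.
  by apply/flattenP; exists V.
- move=> V; rewrite mem_filter => /andP[/allP Vc _]; apply/allP => x xV /=.
  by rewrite uE; have := Vc x xV; lra.
Qed.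

Lemma three_planes F : [::] \notin F -> ~ packing F 8 ->
  exists (u : 'I_3 -> point) (d : 'I_3 -> R), (forall i, u i != 0) /\
    {in F, forall V, exists i : 'I_3, hit (affine (u i) (d i)) V}.
Proof.
move=> nF /(balanced_cut nF)[c [nuA nuB]].
have sub p : [::] \notin [seq V <- F | p V].
  by apply: contra nF; rewrite mem_filter => /andP[].
have [||u [d [u' [d' [u0 u'0 hits]]]]] :=
    @two_planes R (below c F) (above c F) c nuA nuB (sub _) (sub _).
- by move=> V; rewrite mem_filter => /andP[/allP Vc _] x /Vc.
- by move=> V; rewrite mem_filter => /andP[/allP Vc _] x /Vc.
have [w w0 wE] := horizontal c.
exists (fun i => [:: w; u; u']`_i), (fun i => [:: c; d; d']`_i); split.
  by case=> [[|[|[|]]]].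
move=> V VF.
have [hw|] := boolP (hit (affine w c) V); first by exists (@Ordinal 3 0 isT).
rewrite negb_and !negbK => /orP cV.
have /hits/orP[hu|hu'] : V \in below c F ++ above c F.
- rewrite mem_cat !mem_filter VF !andbT orbC.
  case: cV => /allP cV; apply/orP; [left|right]; apply/allP => x /cV.
    by rewrite wE subr_gt0.
  by rewrite /= wE oppr_gt0 subr_lt0.
- by exists (@Ordinal 3 1 isT).
- by exists (@Ordinal 3 2 isT).
Qed.

End SpaceSplit.

(** * Convex hulls and the Kneser hypergraph *)

Section Hulls.
Variable R : realType.
Notation point := 'rV[R]_3.
Implicit Types (V W : seq point) (u : point).

Definition hull V : set point := convex_hull [set` V].

Lemma mem_hull V x : x \in V -> hull V x.
Proof. by move=> xV; apply: (@sub_smallest _ _ _ [set` V]). Qed.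

Lemma affine_combination u d (t : R) (x y : point) :
  affine u d (t *: x + (1 - t) *: y) = t * affine u d x + (1 - t) * affine u d y.
Proof.
rewrite /affine !mulrBr addrACA -opprD -mulrDl addrCA subrr addr0 mul1r.
rewrite !mulr_sumr -big_split /=; congr (_ - _); apply: eq_bigr => i _.
by rewrite !mxE; ring.
Qed.

Lemma hull_convex V (t : R) x y : 0 <= t <= 1 -> hull V x -> hull V y ->
  hull V (t *: x + (1 - t) *: y).
Proof.
move=> /andP[t0 t1] Vx Vy C [Cc VC].
have := Cc x y (Itv01 t0 t1) (mem_set (Vx C (conj Cc VC)))
  (mem_set (Vy C (conj Cc VC))).
exact: set_mem.
Qed.

Lemma hull_pos u d V x : pos (affine u d) V -> hull V x -> 0 < affine u d x.
Proof.
move=> /allP pV; apply: (@smallest_sub _ _ _ [set y | 0 < affine u d y]) => // y z t.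
rewrite !inE /= => y0 z0; rewrite (_ : conv t y z =
  t%:num *: (y : point) + (1 - t%:num) *: (z : point)) //.
rewrite affine_combination.
have t0 : 0 <= t%:num by [].
have t1 : t%:num <= 1 by [].
nra.
Qed.

Lemma hull_neg u d V x : pos (\- affine u d) V -> hull V x -> affine u d x < 0.
Proof.
have opp y : affine (- u) (- d) y = - affine u d y.
  rewrite /affine opprD -sumrN; congr (_ - _).
  by apply: eq_bigr => i _; rewrite mxE mulNr.
move=> pV Vx; rewrite -oppr_gt0 -opp; apply: hull_pos Vx.
by rewrite /pos (eq_all (a2 := fun y => 0 < (\- affine u d) y)) // => y; rewrite opp.
Qed.

(** A hull on neither open side of a plane has vertices in both closed sides,
    and the segment between them crosses the plane. *)
Lemma hull_hit u d V : hit (affine u d) V -> exists2 x, hull V x & affine u d x = 0.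
Proof.
case/andP => /allPn[x xV] + /allPn[y yV]; rewrite -!leNgt /= oppr_le0 => fx fy.
have [fxy|fxy] := eqVneq (affine u d x) (affine u d y).
  by exists x; [exact: mem_hull | lra].
pose t := affine u d y / (affine u d y - affine u d x).
have gap : 0 < affine u d y - affine u d x.
  by rewrite subr_gt0 lt_neqAle fxy (le_trans fx).
exists (t *: x + (1 - t) *: y).
  apply: hull_convex; try exact: mem_hull.
  by rewrite /t divr_ge0 ?(ltW gap) //= ler_pdivrMr // mul1r; lra.
by rewrite affine_combination /t; field; rewrite gt_eqF.
Qed.

Lemma apart_disjoint V W : apart V W -> hull V `&` hull W = set0.
Proof.
move=> /asboolP[u [d [fV fW]]]; apply/seteqP; split=> // x [/(hull_pos fV) x0].
by move=> /(hull_neg fW); lra.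
Qed.

Lemma kneser_edge (G : seq (seq point)) (F : set (set point)) k :
  {in G, forall V, V != [::] /\ F (hull V)} -> packing G k ->
  exists e, hyperedges (kneser k F) e.
Proof.
move=> GF [s [sk sG ps]]; pose h i := hull (nth [::] s i).
have disj i j : (i < k)%N -> (j < k)%N -> (i < j)%N -> h i `&` h j = set0.
  move=> ik jk ij; apply: apart_disjoint.
  by move/(pairwiseP [::]): ps; apply; rewrite ?inE ?sk.
have disjn i j : (i < k)%N -> (j < k)%N -> i != j -> h i `&` h j = set0.
  move=> ik jk; rewrite neq_ltn => /orP[ij|ij]; first exact: disj.
  by rewrite setIC disj.
have hs i : (i < k)%N -> F (h i) /\ h i !=set0.
  rewrite -sk => ik; have [V0 FV] := GF _ (sG _ (mem_nth [::] ik)).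
  split=> //; rewrite /h; case: (nth _ _ _) V0 => // x V _.
  by exists x; apply: mem_hull; rewrite mem_head.
have hinj i j : (i < k)%N -> (j < k)%N -> h i `&` h j !=set0 -> i = j.
  move=> ik jk [x hx]; apply/eqP/negPn/negP => ij.
  by move: hx; rewrite disjn.
exists (h @` `I_k); split.
- by move=> _ [i ik <-]; case: (hs i ik).
- apply: inj_card_eq => i j.
  rewrite !inE /= => ik jk hij; apply: hinj => //.
  by rewrite -hij setIid; case: (hs i ik).
- by move=> _ _ [i ik <-] [j jk <-] /(hinj _ _ ik jk) ->.
Qed.

Lemma polytope_hull (P : set point) : polytope P ->
  exists2 V, V != [::] & P = hull V.
Proof.
case=> S [/finite_seqP[V ->] [x xV] ->]; exists V => //.
by apply/eqP => V0; rewrite V0 in xV.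
Qed.

End Hulls.

(** With a single colour every hyperedge would be monochromatic. *)
Lemma no_hyperedge_of_chromatic_number1 (T : Type) (H : hypergraph T) e :
  chromatic_number H = 1%N -> hyperedges H e -> e `<=` vertices H -> False.
Proof.
rewrite /chromatic_number; case: xgetP => // k -> [[c [cH cE]] _] k1 He eH.
apply: (cE e He); exists 0%N => v /eH/cH; rewrite k1; by case: (c v).
Qed.

Close Scope ring_scope.

Theorem theorem1p7 (R : realType) (F : set (set 'rV[R]_3))
  (finF : finite_set F)
  (polF : forall P : set 'rV[R]_3, F P -> polytope P)
  (chiF : chromatic_number (kneser 8 F) = 1%N) :
  pierced_by 3 F.
Proof.
have [Ps FE] := iffLR (finite_seqP F) finF.
have [vert vertP] : {vert : set 'rV[R]_3 -> seq 'rV[R]_3 &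
    forall P, F P -> vert P != [::] /\ P = hull (vert P)}.
  apply: (@choice _ _ (fun P V => F P -> V != [::] /\ P = hull V)) => P.
  have [FP|nFP] := pselect (F P); last by exists [::].
  by have [V V0 PV] := polytope_hull (polF P FP); exists V.
have inF P : P \in Ps -> F P by rewrite FE.
pose G := map vert Ps.
have GF : {in G, forall V, V != [::] /\ F (hull V)}.
  by move=> V /mapP[P /inF FP ->]; have [? <-] := vertP P FP.
have [||u [d [u0 hits]]] := @three_planes R G.
- by apply/negP => /GF[].
- move=> /(kneser_edge GF)[e eE].
  apply: (no_hyperedge_of_chromatic_number1 chiF eE).
  by case: eE.
exists (fun i => [set x | (\sum_(j < 3) u i ord0 j * x ord0 j)%R = d i]); split.
  by move=> i; exists (u i), (d i).
move=> P FP; have [_ PE] := vertP P FP.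
have [|i /hull_hit[x Vx fx]] := hits (vert P).
  by apply: map_f; rewrite FE in FP.
exists x; split; last by rewrite PE.
by exists i => //; apply/eqP; rewrite /= -GRing.subr_eq0; apply/eqP.
Qed.
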